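(* Let $m\ge 2$ and $n\ge 1$ be integers. For $\pi\in[0,1]$ let $\rho(\pi)$ denote the largest $r\in[0,1]$ satisfying $$r=\bigl(1-(1-\pi r)^n\bigr)^m .$$ Then there is a value $\pi_{\mathrm{crit}}\in(0,1]$ such that: (i) $\rho(\pi)=0$ for all $\pi<\pi_{\mathrm{crit}}$; (ii) $\rho$ has a unique point of discontinuity, at $\pi_{\mathrm{crit}}$; (iii) $\rho(\pi)$ is strictly increasing for $\pi\ge\pi_{\mathrm{crit}}$; (iv) $\lim_{\pi\downarrow\pi_{\mathrm{crit}}}\frac{\partial\rho(\pi)}{\partial\pi}=\infty$, $\lim_{\pi\uparrow1}\frac{\partial\rho(\pi)}{\partial\pi}=0$, and $\frac{\partial\rho(\pi)}{\partial\pi}$ is otherwise finite (i.e. $\rho$ has a finite derivative at every $\pi\in(0,1)$ with $\pi\neq\pi_{\mathrm{crit}}$).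
   Context: The domain of $\rho$ is $[0,1]$, and all limits and monotonicity statements are understood within this domain; in particular, if $\pi_{\mathrm{crit}}=1$, the statement about the limit $\pi\downarrow\pi_{\mathrm{crit}}$ is vacuous. Interpretation: $\rho(\pi)$ is the probability that a task can be completed in an infinite-depth tree of tasks in which each task needs $m$ types of inputs, each type having $n$ substitutable subtasks, and each link is independently operational with probability $\pi$. *)

(* Defs.v *)
From mathcomp Require Import all_boot all_order all_algebra.
From mathcomp Require Import all_classical all_reals all_analysis.

Set Implicit Arguments.
Unset Strict Implicit.
Unset Printing Implicit Defensive.

Import Order.TTheory GRing.Theory Num.Theory.
Import numFieldNormedType.Exports.

Local Open Scope classical_set_scope.
Local Open Scope ring_scope.

Definition completion_fixpoints (R : realType) (m n : nat) (p : R) : set R :=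
  [set r | 0 <= r <= 1 /\ r = (1 - (1 - p * r) ^+ n) ^+ m].

Definition is_largest (R : realType) (A : set R) (r : R) : Prop :=
  A r /\ ubound A r.

(* The default value 0 of [xget] is never used when 0 < m and 0 < n:
   see [rho_is_largest]. *)
Definition rho (R : realType) (m n : nat) (p : R) : R :=
  xget 0 [set r | is_largest (completion_fixpoints m n p) r].

Lemma rho_is_largest (R : realType) (m n : nat) (p : R) :
  (0 < m)%N -> (0 < n)%N ->
  is_largest (completion_fixpoints m n p) (rho m n p).
Proof.
move=> m0 n0; apply: (@xgetPex _ 0
  [set r | is_largest (completion_fixpoints m n p) r]).
set A := completion_fixpoints m n p.
pose q : {poly R} := 'X - (1 - (1 - p *: 'X) ^+ n) ^+ m.
have AE : A = `[0, 1]%classic `&` ((fun x => q.[x]) @^-1` [set 0]).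
  apply/seteqP; split => [r [r01 rE]|r [/= r01 qr]].
    split => /=; first by rewrite in_itv.
    by rewrite /q !hornerE -rE subrr.
  split; first by rewrite in_itv in r01.
  by apply/eqP; rewrite -subr_eq0 -qr /q !hornerE.
have A0 : A !=set0.
  exists 0; split; first by rewrite lexx ler01.
  by rewrite mulr0 subr0 expr1n subrr expr0n gtn_eqF.
have cA : compact A.
  rewrite AE; apply: compact_closedI; first exact: segment_compact.
  apply: preimage_closed => [x _|]; first exact: continuous_horner.
  exact: closed_eq.
have [|c cA' cmax] := @compact_EVT_max R R id A A0 cA.
  by apply: continuous_subspaceT => x; exact: cvg_id.
exists c; split; first by rewrite inE in cA'.
by move=> x Ax; apply: cmax; rewrite inE.
Qed.

(* Continuity of [f] at [x] as a function with domain [D]. *)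
Definition discontinuities (R : realType) (D : set R) (f : R -> R) : set R :=
  [set x | D x /\ ~ (f y @[y --> within D (nbhs x)] --> f x)].

(* Main.v *)
(* Substitute u = 1 - p r, the probability that a given subtask is unavailable.
   As 1 - u^n = (1 - u) S(u) with S(u) = 1 + u + ... + u^(n-1), the positive
   solutions r correspond to the u in [0, 1[ with p P(u) = 1, where
   P(u) = (1 - u)^(m-1) S(u)^m.  The sign of P'(u) is that of
   K(u) = S(u) - m n u^(n-1), and K(u) / u^(n-1) is decreasing, so P increases
   on [0, c] from P(0) = 1 and then decreases.  Hence the critical value is
   1 / P(c): below it there is no positive solution, above it the largest r
   corresponds to the smallest u, so that u is the inverse of 1 / P on [0, c] and
   rho = (1 - u^n)^m.  The derivative of rho is a quotient with denominator P'(u),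
   which vanishes at u = c; its numerator vanishes at u = 0, that is, at p = 1.
   For n = 1 one has c = 0 and everything happens at p = 1. *)
Require Import Defs.
From mathcomp Require Import all_boot all_order all_algebra.
From mathcomp Require Import all_classical all_reals all_analysis.
From mathcomp Require Import ring.

Import Order.TTheory GRing.Theory Num.Theory.
Import numFieldNormedType.Exports.

Local Open Scope classical_set_scope.
Local Open Scope ring_scope.

Set Implicit Arguments.
Unset Strict Implicit.
Unset Printing Implicit Defensive.

(** * The polynomials S, P and K of the outline: [geom], [invp] and [crit_poly] *)

Definition geom (R : realType) (n : nat) : {poly R} := \sum_(k < n) 'X^k.

(* On the supercritical branch [p] is the inverse of the value of [invp] at
   [u = 1 - p * rho p]. *)
Definition invp (R : realType) (m n : nat) : {poly R} :=
  (1 - 'X) ^+ m.-1 * geom R n ^+ m.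

Definition crit_poly (R : realType) (m n : nat) : {poly R} :=
  geom R n - 'X^(n.-1) *+ (m * n).

Lemma mul_geom (R : realType) n : (1 - 'X) * geom R n = 1 - 'X^n.
Proof. by rewrite /geom -[RHS]opprB subrX1 -mulNr opprB. Qed.

(** Obtained by differentiating [mul_geom], whose left side contributes [- geom R n] besides the
    product shown here. *)
Lemma mul_deriv_geom (R : realType) n :
  (1 - 'X) * (geom R n)^`() = geom R n - 'X^(n.-1) *+ n.
Proof.
have /(congr1 deriv) := mul_geom R n.
rewrite derivM !derivB derivX derivXn -polyC1 derivC !sub0r polyC1 => h.
have -> : (1 - 'X) * (geom R n)^`()
  = geom R n + (-1 * geom R n + (1 - 'X) * (geom R n)^`()) by ring.
by rewrite h.
Qed.

(** The product rule leaves a factor (1 - X) S', which [mul_deriv_geom] replaces by S - n X^(n-1).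
    Writing [m.+2] keeps truncated predecessors of [m] out of the exponents. *)
Lemma deriv_invp (R : realType) m n :
  (invp R m.+2 n)^`() = (1 - 'X) ^+ m * geom R n ^+ m.+1 * crit_poly R m.+2 n.
Proof.
rewrite /invp /= derivM !deriv_exp derivB derivX -polyC1 derivC sub0r polyC1.
have S := mul_deriv_geom R n.
rewrite [X in _ + X](_ : _ = (1 - 'X) ^+ m * geom R n ^+ m.+1 *
    ((geom R n - 'X^(n.-1) *+ n) *+ m.+2)); last by rewrite -S !exprS /=; ring.
by rewrite /crit_poly mulrnBl -mulrnA mulnC !exprS /=; ring.
Qed.

Lemma geom_horner (R : realType) n (u : R) : (geom R n).[u] = \sum_(k < n) u ^+ k.
Proof. by rewrite horner_sum; apply: eq_bigr => k _; rewrite hornerXn. Qed.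

Lemma geom_ge1 (R : realType) n (u : R) : (0 < n)%N -> 0 <= u -> 1 <= (geom R n).[u].
Proof.
case: n => // n _ u0; rewrite geom_horner big_ord_recl expr0 lerDl.
by apply: sumr_ge0 => k _; rewrite exprn_ge0.
Qed.

Lemma geom_gt0 (R : realType) n (u : R) : (0 < n)%N -> 0 <= u -> 0 < (geom R n).[u].
Proof. by move=> n0 u0; exact: lt_le_trans ltr01 (geom_ge1 n0 u0). Qed.

(** At u = 1 - p r this turns the fixpoint equation into r = p r P(u), from which a positive r
    cancels. *)
Lemma completion_invp (R : realType) m n (u : R) : (0 < m)%N ->
  (1 - u ^+ n) ^+ m = (1 - u) * (invp R m n).[u].
Proof.
case: m => // m _; have := congr1 (horner^~ u) (mul_geom R n).
rewrite /invp !hornerE => <-.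
by rewrite !exprS exprMn /=; ring.
Qed.

Lemma invp_gt0 (R : realType) m n (u : R) : (0 < n)%N -> 0 <= u -> u < 1 ->
  0 < (invp R m n).[u].
Proof.
move=> n0 u0 u1; rewrite /invp !hornerE mulr_gt0// exprn_gt0 ?geom_gt0//.
by rewrite subr_gt0.
Qed.

Lemma invp0 (R : realType) m n : (0 < n)%N -> (invp R m n).[0] = 1.
Proof.
case: n => // n _; rewrite /invp !hornerE geom_horner big_ord_recl.
by rewrite subr0 expr1n expr0 big1 ?addr0 ?expr1n ?mul1r// => k _; rewrite expr0n.
Qed.

(** * The sign of K and the maximum of P on [0, 1] *)

Lemma crit_poly_horner (R : realType) m n (u : R) :
  (crit_poly R m n).[u] = \sum_(k < n) u ^+ k - (m * n)%:R * u ^+ n.-1.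
Proof. by rewrite /crit_poly hornerD hornerN geom_horner hornerMn hornerXn mulr_natl. Qed.

(* [crit_poly] divided by [u ^+ n.-1] is decreasing in [u]. *)
Lemma crit_poly_cross (R : realType) m n (u v : R) : (1 < n)%N -> 0 <= u -> u < v ->
  (crit_poly R m n).[v] * u ^+ n.-1 < (crit_poly R m n).[u] * v ^+ n.-1.
Proof.
case: n => [//|[//|n]] _ u0 uv; rewrite !crit_poly_horner !mulrBl /=.
(* The terms with [m * n] agree on both sides and cancel. Strictness comes from the summand k = 0,
   where 1 < n matters; the others are compared weakly. *)
rewrite mulrAC ltrD2r !mulr_suml.
rewrite big_ord_recl [ltRHS]big_ord_recl expr0 !mul1r.
rewrite ltr_leD ?ltrXn2r ?nnegrE ?(ltW (le_lt_trans u0 uv))//.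
have v0 : 0 <= v := ltW (le_lt_trans u0 uv).
apply: ler_sum => -[k kn] _; rewrite /= /bump/= add1n.
(* Both sides share the factor u^(k+1) v^(k+1); what remains is u^(n-k) <= v^(n-k). *)
have -> : n.+1 = (k.+1 + (n - k))%N by rewrite addSn subnKC// -ltnS.
rewrite !exprD !mulrA [v ^+ _ * _]mulrC.
apply: ler_wpM2l; first by rewrite mulr_ge0// exprn_ge0.
by rewrite lerXn2r// ltW.
Qed.

(** For n > 1, [c] is a root of K given by the intermediate value theorem, since K(0) = 1 and K(1) =
    n - m n < 0; comparing with [c] through [crit_poly_cross] yields the signs. For n = 1 there is
    no root, hence the guard [0 < c] in the last clause. *)
Lemma crit_poly_sign (R : realType) m n : (1 < m)%N -> (0 < n)%N ->
  exists c : R, [/\ 0 <= c, c < 1,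
    (forall u, 0 <= u -> u < c -> 0 < (crit_poly R m n).[u]),
    (forall u, c < u -> (crit_poly R m n).[u] < 0) &
    (0 < c -> (1 < n)%N /\ (crit_poly R m n).[c] = 0)].
Proof.
move=> m1; case: n => [//|[|n]] _.
  (* For n = 1, K is the negative constant 1 - m. *)
  exists 0; split => //; first by move=> u; rewrite leNgt => /negP.
    move=> u _; rewrite crit_poly_horner big_ord1 !expr0 muln1 mulr1 subr_lt0.
    by rewrite ltr1n.
  by rewrite ltxx.
pose K := crit_poly R m n.+2.
have K0 : K.[0] = 1.
  rewrite crit_poly_horner big_ord_recl expr0 big1 => [|k _]; last by rewrite expr0n.
  by rewrite expr0n mulr0 subr0 addr0.
have K1 : K.[1] < 0.
  rewrite crit_poly_horner (eq_bigr (fun=> 1)) => [|k _]; last by rewrite expr1n.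
  by rewrite sumr_const card_ord expr1n mulr1 subr_lt0 ltr_nat -{1}[n.+2]mul1n ltn_pmul2r.
have [c c01 Kc] : exists2 c : R, c \in `[0, 1]%R & K.[c] = 0.
  apply: (@IVT R (horner K) 0 1 0); first exact: ler01.
    by apply: continuous_subspaceT => x; exact: continuous_horner.
  by rewrite K0 ge_min le_max ler01 (ltW K1) orbT.
move: c01; rewrite in_itv/= => /andP[c0 c1].
have cgt0 : 0 < c.
  by rewrite lt_neqAle c0 andbT; apply/eqP => c0'; move: Kc; rewrite -c0' K0 => /eqP; rewrite oner_eq0.
exists c; split => //.
- rewrite lt_neqAle c1 andbT; apply/eqP => c1'.
  by move: K1; rewrite -c1' Kc ltxx.
- move=> u u0 uc; have := @crit_poly_cross R m n.+2 u c isT u0 uc.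
  by rewrite -/K Kc mul0r pmulr_lgt0// exprn_gt0.
- move=> u cu; have := @crit_poly_cross R m n.+2 c u isT c0 cu.
  by rewrite -/K Kc mul0r pmulr_llt0// exprn_gt0.
Qed.

(** On [0, 1[ the other factors of P' in [deriv_invp] are positive, so P' inherits the sign of K. *)
Lemma invp_crit (R : realType) m n : (1 < m)%N -> (0 < n)%N ->
  exists c : R, [/\ 0 <= c < 1,
    {in `[0, c] &, {homo horner (invp R m n) : x y / x < y}},
    (forall u, 0 <= u <= 1 -> (invp R m n).[u] <= (invp R m n).[c]),
    (forall u, 0 <= u -> u < c -> 0 < (invp R m n)^`().[u]) &
    (0 < c -> (1 < n)%N /\ (invp R m n)^`().[c] = 0)].
Proof.
move=> m1 n0; have [c [c0 c1 Kpos Kneg Kc]] := crit_poly_sign R m1 n0.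
have P'E u : (invp R m n)^`().[u] =
    (1 - u) ^+ m.-2 * (geom R n).[u] ^+ m.-1 * (crit_poly R m n).[u].
  by case: m m1 {Kpos Kneg Kc} => [//|[//|m]] _; rewrite deriv_invp !hornerE.
have P'gt0 u : 0 <= u -> u < c -> 0 < (invp R m n)^`().[u].
  move=> u0 uc; rewrite P'E !mulr_gt0// ?Kpos// exprn_gt0 ?geom_gt0//.
  by rewrite subr_gt0 (lt_trans uc).
have P'lt0 u : c < u -> u < 1 -> (invp R m n)^`().[u] < 0.
  move=> cu u1; rewrite P'E pmulr_rlt0 ?Kneg// mulr_gt0// exprn_gt0 ?geom_gt0//.
    by rewrite subr_gt0.
  exact: le_trans (ltW cu).
have dP u : derivable (horner (invp R m n)) u 1 by exact: derivable_horner.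
have cP (A : set R) : {within A, continuous (horner (invp R m n))}.
  by apply: continuous_subspaceT => x; exact: continuous_horner.
have incP : {in `[0, c] &, {homo horner (invp R m n) : x y / x < y}}.
  apply: gtr0_derive1_lt_cc => [u _|u|]; [exact: dP| |exact: cP].
  by rewrite in_itv/= -derivE => /andP[u0 uc]; rewrite P'gt0// ltW.
exists c; split => //; first by rewrite c0.
  move=> u /andP[u0 u1]; have [uc|cu|->//] := ltgtP u c.
    by apply/ltW/incP => //; rewrite in_itv/= ?lexx ?u0 ?c0 ?(ltW uc).
  apply/ltW; apply: (@ltr0_derive1_lt_cc _ (horner (invp R m n)) c 1) => //.
  - move=> x; rewrite in_itv/= -derivE => /andP[cx x1]; exact: P'lt0.
  - by rewrite in_itv/= ltW.
  - by rewrite in_itv/= lexx ltW.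
by move=> /Kc[n1 Kc0]; split => //; rewrite P'E Kc0 mulr0.
Qed.

(** * The largest fixpoint expressed through P *)

Lemma rho_fixpoint (R : realType) m n (p : R) : (0 < m)%N -> (0 < n)%N ->
  rho m n p = (1 - (1 - p * rho m n p) ^+ n) ^+ m.
Proof. by move=> m0 n0; have [[_ ?] _] := rho_is_largest p m0 n0. Qed.

Lemma rho_itv (R : realType) m n (p : R) : (0 < m)%N -> (0 < n)%N ->
  0 <= rho m n p <= 1.
Proof. by move=> m0 n0; have [[? _] _] := rho_is_largest p m0 n0. Qed.

Lemma rho_invp (R : realType) m n (p : R) : (0 < m)%N -> (0 < n)%N ->
  0 < rho m n p -> p * (invp R m n).[1 - p * rho m n p] = 1.
Proof.
move=> m0 n0 r0; have := rho_fixpoint p m0 n0.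
rewrite completion_invp// subKr mulrAC -[LHS]mul1r => /esym.
by apply: mulIf; rewrite gt_eqF.
Qed.

(** A positive solution would give 1 = p P(u) <= p P(c) < 1. *)
Lemma rho_subcritical (R : realType) m n (c p : R) : (0 < m)%N -> (0 < n)%N ->
  0 <= c < 1 ->
  (forall u, 0 <= u <= 1 -> (invp R m n).[u] <= (invp R m n).[c]) ->
  0 <= p <= 1 -> p < (invp R m n).[c]^-1 -> rho m n p = 0.
Proof.
move=> m0 n0 /andP[c0 c1] Pmax /andP[p0 p1] ppc.
have /andP[r0 r1] := rho_itv p m0 n0.
move: r0; rewrite le_eqVlt => /predU1P[//|r0].
have := rho_invp m0 n0 r0.
have /Pmax Pm : 0 <= 1 - p * rho m n p <= 1.
  by rewrite subr_ge0 mulr_ile1 ?(ltW r0)//= lerBlDr lerDl mulr_ge0// ltW.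
move=> e; suff : (1 : R) < 1 by rewrite ltxx.
rewrite -{1}e (le_lt_trans (ler_wpM2l p0 Pm))//.
by rewrite -ltr_pdivlMr ?invp_gt0// mul1r.
Qed.

(** With p = 1 / P(u), the number (1 - u^n)^m is a fixpoint, so maximality of [rho] gives 1 - p
    rho(p) <= u. A strict inequality would make P take the value 1 / p at two points of [0, c],
    against monotonicity. *)
Lemma rho_branch (R : realType) m n (c u : R) : (0 < m)%N -> (0 < n)%N -> c < 1 ->
  {in `[0, c] &, {homo horner (invp R m n) : x y / x < y}} -> u \in `[0, c]%R ->
  1 - (invp R m n).[u]^-1 * rho m n (invp R m n).[u]^-1 = u.
Proof.
move=> m0 n0 c1 incP uc; move: (uc); rewrite in_itv/= => /andP[u0 uc'].
have u1 : u < 1 by exact: le_lt_trans c1.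
have Pu0 : 0 < (invp R m n).[u] by exact: invp_gt0.
set p := (invp R m n).[u]^-1; have p0 : 0 < p by rewrite invr_gt0.
have pr0 : p * (1 - u ^+ n) ^+ m = 1 - u.
  by rewrite completion_invp// mulrCA mulVf ?mulr1 ?gt_eqF.
have : completion_fixpoints m n p ((1 - u ^+ n) ^+ m).
  split; last by rewrite pr0 subKr.
  have un1 : u ^+ n <= 1 by rewrite exprn_ile1// ltW.
  rewrite exprn_ge0 ?subr_ge0//= exprn_ile1 ?subr_ge0//.
  by rewrite lerBlDr lerDl exprn_ge0.
move=> /(rho_is_largest p m0 n0).2 r0r.
have pr : 1 - p * rho m n p <= u.
  by rewrite lerBlDr addrC -lerBlDr -pr0 ler_pM2l.
have r0 : 0 < rho m n p.
  by rewrite (lt_le_trans _ r0r)// -(pmulr_rgt0 _ p0) pr0 subr_gt0.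
have e := rho_invp m0 n0 r0.
(* P(u) >= P(0) = 1; this bound keeps 1 - p rho(p) nonnegative, hence inside [0, c]. *)
have p1 : p <= 1.
  rewrite invf_le1// -(@invp0 R m n)//; move: u0; rewrite le_eqVlt.
  move=> /predU1P[<-//|u0]; apply/ltW/incP => //.
  by rewrite in_itv/= lexx (le_trans _ uc')// ltW.
have pr1 : 0 <= 1 - p * rho m n p.
  rewrite subr_ge0 mulr_ile1 ?(ltW p0) ?(ltW r0)//.
  by have /andP[] := rho_itv p m0 n0.
apply/eqP; rewrite eq_le pr /= leNgt; apply/negP => ltu.
suff : (invp R m n).[1 - p * rho m n p] < (invp R m n).[u].
  rewrite -(ltr_pM2l p0) e mulVf ?ltxx// gt_eqF//.
by apply: incP => //; rewrite in_itv/= pr1 (le_trans pr).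
Qed.

Lemma branch_surj (R : realType) m n (c p : R) : (0 < n)%N -> 0 <= c < 1 ->
  (invp R m n).[c]^-1 <= p -> p <= 1 ->
  exists2 u, u \in `[0, c]%R & p = (invp R m n).[u]^-1.
Proof.
move=> n0 /andP[c0 c1] pcp p1.
have Pc0 : 0 < (invp R m n).[c] by exact: invp_gt0.
have p0 : 0 < p by rewrite (lt_le_trans _ pcp)// invr_gt0.
have pPc : p^-1 <= (invp R m n).[c].
  by rewrite -[leRHS]invrK lef_pV2 ?posrE ?invr_gt0.
have [||u uc Pu] := @IVT R (horner (invp R m n)) 0 c p^-1 c0.
- by apply: continuous_subspaceT => x; exact: continuous_horner.
- by rewrite invp0// ge_min le_max invf_ge1// p1 pPc orbT.
by exists u => //; rewrite Pu invrK.
Qed.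

(** * Continuity and derivative of [rho] on the supercritical branch *)

Lemma rho_comp (R : realType) m n : (0 < m)%N -> (0 < n)%N ->
  @rho R m n = horner ((1 - 'X^n) ^+ m) \o (fun p => 1 - p * rho m n p).
Proof. by move=> m0 n0; apply/funext => p /=; rewrite !hornerE -rho_fixpoint. Qed.

Lemma is_derive_horner (R : realType) (q : {poly R}) (x : R) :
  is_derive x 1 (horner q) q^`().[x].
Proof. by rewrite derivE; apply: DeriveDef; [exact: derivable_horner|rewrite derive1E]. Qed.

(** By [rho_branch] this function is a left inverse of the continuous map u -> 1 / P(u) on the
    segment [0, c]. *)
Lemma branch_continuous (R : realType) m n (c : R) : (0 < m)%N -> (0 < n)%N ->
  0 <= c < 1 ->
  {in `[0, c] &, {homo horner (invp R m n) : x y / x < y}} ->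
  {within `[(invp R m n).[c]^-1, 1], continuous (fun p : R => 1 - p * rho m n p)}.
Proof.
move=> m0 n0 /andP[c0 c1] incP.
have := @segment_can_ge_continuous R 0 c (fun u => (invp R m n).[u]^-1)
  (fun p => 1 - p * rho m n p) c0.
rewrite invp0// invr1; apply; last by move=> u /(rho_branch m0 n0 c1 incP).
apply: continuous_in_subspaceT => u; rewrite inE/= in_itv/= => /andP[u0 uc].
apply: continuousV; last exact: continuous_horner.
by rewrite gt_eqF// invp_gt0// (le_lt_trans uc).
Qed.

Lemma rho_continuous (R : realType) m n (c : R) : (0 < m)%N -> (0 < n)%N ->
  0 <= c < 1 ->
  {in `[0, c] &, {homo horner (invp R m n) : x y / x < y}} ->
  {within `[(invp R m n).[c]^-1, 1], continuous (@rho R m n)}.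
Proof.
move=> m0 n0 c01 incP; have /subspace_continuousP cV := branch_continuous m0 n0 c01 incP.
rewrite rho_comp//; apply/subspace_continuousP => p /cV cVp.
exact: (cvg_comp _ _ cVp (@continuous_horner _ _ _)).
Qed.

(** The inverse of u -> 1 / P(u) has derivative - P(u)^2 / P'(u); the chain rule through [rho_comp]
    does the rest. *)
Lemma rho_branch_derive (R : realType) m n (c u : R) : (0 < m)%N -> (0 < n)%N ->
  c < 1 ->
  {in `[0, c] &, {homo horner (invp R m n) : x y / x < y}} ->
  (forall u, 0 <= u -> u < c -> 0 < (invp R m n)^`().[u]) ->
  0 < u -> u < c ->
  is_derive (invp R m n).[u]^-1 1 (@rho R m n)
    ((m * n)%:R * (1 - u ^+ n) ^+ m.-1 * u ^+ n.-1 * (invp R m n).[u] ^+ 2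
      / (invp R m n)^`().[u]).
Proof.
move=> m0 n0 c1 incP P'gt0 u0 uc.
have Pu0 : 0 < (invp R m n).[u] by rewrite invp_gt0 ?ltW// (lt_trans uc).
have P'u0 : 0 < (invp R m n)^`().[u] by rewrite P'gt0// ltW.
have dP : is_derive u 1 (horner (invp R m n)) (invp R m n)^`().[u].
  exact: is_derive_horner.
have dphi := is_deriveV (lt0r_neq0 Pu0) dP.
have dV : is_derive (invp R m n).[u]^-1 1 (fun p => 1 - p * rho m n p)
    (- (invp R m n).[u] ^- 2 *: (invp R m n)^`().[u])^-1.
  apply: (@is_derive_inverse _ (fun x => (invp R m n).[x]^-1)) => //.
  - near=> x; apply: (rho_branch m0 n0 c1 incP); rewrite in_itv/=.
    by apply/andP; split; apply/ltW; near: x; [exact: lt_nbhsr|exact: lt_nbhsl].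
  - near=> x; apply: continuousV; last exact: continuous_horner.
    rewrite gt_eqF// invp_gt0//.
      by apply/ltW; near: x; exact: lt_nbhsr.
    by apply: lt_trans c1; near: x; exact: lt_nbhsl.
  - by rewrite mulf_neq0 ?oppr_eq0 ?invr_eq0 ?expf_eq0 ?gt_eqF.
have := is_derive1_comp (is_derive_horner ((1 - 'X^n) ^+ m) _) dV; rewrite -rho_comp//.
rewrite (rho_branch m0 n0 c1 incP); last by rewrite in_itv/= !ltW.
move=> /is_derive_eq; apply.
have -> : ((1 - 'X^n) ^+ m)^`().[u]
  = - ((m * n)%:R * (1 - u ^+ n) ^+ m.-1 * u ^+ n.-1).
  rewrite deriv_exp derivB derivXn -polyC1 derivC sub0r polyC1.
  by rewrite !(hornerE, hornerMn) -[in LHS]mulr_natr natrM; ring.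
rewrite -[_ *: _]/(_ * _); field.
by rewrite !gt_eqF.
Unshelve. all: by end_near. Qed.


(** * Monotonicity of [rho] and its jump *)

Lemma rho_increasing (R : realType) m n (c p q : R) : (0 < m)%N -> (0 < n)%N ->
  0 <= c < 1 ->
  {in `[0, c] &, {homo horner (invp R m n) : x y / x < y}} ->
  (invp R m n).[c]^-1 <= p -> p < q -> q <= 1 -> rho m n p < rho m n q.
Proof.
move=> m0 n0 c01 incP pcp pq q1.
have c1 : c < 1 by case/andP: c01.
have pcq := le_trans pcp (ltW pq).
have [u uc pE] := branch_surj n0 c01 pcp (ltW (lt_le_trans pq q1)).
have [v vc qE] := branch_surj n0 c01 pcq q1.
rewrite [ltLHS]rho_fixpoint// [ltRHS]rho_fixpoint//.
rewrite pE qE !(rho_branch m0 n0 c1 incP)//.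
move: (uc) (vc); rewrite !in_itv/= => /andP[u0 uc'] /andP[v0 vc'].
have u1 := le_lt_trans uc' c1; have v1 := le_lt_trans vc' c1.
(* The larger argument [q] has the smaller parameter, because 1 / P reverses the order on [0, c]. *)
have vu : v < u.
  have : (invp R m n).[v] < (invp R m n).[u].
    by move: pq; rewrite pE qE ltf_pV2// posrE invp_gt0.
  apply: contraTT; rewrite -!leNgt le_eqVlt => /predU1P[->//|uv].
  by apply/ltW/incP.
have un1 : u ^+ n <= 1 by rewrite exprn_ile1// ltW.
have vn1 : v ^+ n <= 1 by rewrite exprn_ile1// ltW.
rewrite ltrXn2r ?nnegrE ?subr_ge0 -?lt0n//.
by rewrite ltrD2l ltrN2 ltrXn2r ?nnegrE -?lt0n.
Qed.

Lemma rho_discontinuities (R : realType) m n (c : R) : (0 < m)%N -> (0 < n)%N ->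
  0 <= c < 1 ->
  {in `[0, c] &, {homo horner (invp R m n) : x y / x < y}} ->
  (forall u, 0 <= u <= 1 -> (invp R m n).[u] <= (invp R m n).[c]) ->
  discontinuities `[0, 1] (@rho R m n) = [set (invp R m n).[c]^-1].
Proof.
move=> m0 n0 c01 incP Pmax; have /andP[c0 c1] := c01.
have Pc0 : 0 < (invp R m n).[c] by exact: invp_gt0.
have rho0 p : 0 <= p <= 1 -> p < (invp R m n).[c]^-1 -> rho m n p = 0.
  exact: rho_subcritical.
have /subspace_continuousP cont := rho_continuous m0 n0 c01 incP.
set pc := (invp R m n).[c]^-1 in rho0 cont *.
have pc0 : 0 < pc by rewrite invr_gt0.
have pc1 : pc <= 1 by rewrite invf_le1// -(@invp0 R m n)// Pmax// lexx ler01.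
apply/seteqP; split => [p [/= p01 dis]|p /= ->{p}].
  move: (p01); rewrite in_itv/= => /andP[p0 p1].
  have [pltpc|pcltp|//] := ltgtP p pc; exfalso; apply: dis.
    rewrite [rho m n p]rho0 ?p0//; apply: cvg_near_cst.
    near=> y; rewrite rho0//.
      have : [set` `[(0 : R), 1]] y by near: y; exact: withinT.
      by rewrite /= in_itv.
    by near: y; apply: cvg_within; exact: lt_nbhsl.
  (* Near a point above [pc], the domains [0, 1] and [pc, 1] coincide, so continuity transfers. *)
  have ppc1 : [set` `[pc, 1]] p by rewrite /= in_itv/= (ltW pcltp).
  apply: cvg_trans (cont p ppc1); apply: cvg_app.
  move=> A pA; apply: filterS2 (lt_nbhsr pcltp) pA => y pcy Ay y01; apply: Ay.
  by move: y01; rewrite /= !in_itv/= => /andP[_ ->]; rewrite ltW.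
split; first by rewrite /= in_itv/= pc1 ltW.
(* The jump: pc rho(pc) = 1 - c > 0, whereas [rho] vanishes just to the left of [pc]. *)
have rpc : 0 < rho m n pc.
  have cc : c \in `[0, c]%R by rewrite in_itv/= c0 lexx.
  have := rho_branch m0 n0 c1 incP cc; rewrite -/pc => e.
  by rewrite -(pmulr_rgt0 _ pc0) -(subKr 1 (pc * _)) e subr_gt0.
move=> /cvgrPdist_lt/(_ _ rpc); rewrite /within/= => near_pc.
have [y] : exists y, [/\ 0 <= y, y < pc &
    y \in `[0, 1]%R -> `|rho m n pc - rho m n y| < rho m n pc].
  near pc^'- => y; exists y; split => //.
    by near: y; exact: nbhs_left_ge.
  by near: y; apply: cvg_within; exact: near_pc.
move=> [y0 ypc]; have y01 : 0 <= y <= 1 by rewrite y0 (le_trans (ltW ypc)).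
by rewrite in_itv => /(_ y01); rewrite [rho m n y]rho0// subr0 gtr0_norm// ltxx.
Unshelve. all: by end_near. Qed.

(** * The limits of the derivative at the critical value and at 1 *)

Unset Implicit Arguments.

Theorem lemma1 (R : realType) (m n : nat) (hm : (2 <= m)%N) (hn : (1 <= n)%N) :
  exists pcrit : R,
    [/\ 0 < pcrit <= 1,
        (forall p : R, 0 <= p <= 1 -> p < pcrit -> rho m n p = 0),
        discontinuities `[0, 1] (@rho R m n) = [set pcrit],
        (forall p q : R, pcrit <= p -> p < q -> q <= 1 ->
           rho m n p < rho m n q) &
        [/\ (pcrit < 1 -> derive1 (@rho R m n) p @[p --> pcrit^'+] --> +oo),
            derive1 (@rho R m n) p @[p --> 1^'-] --> (0 : R) &
            (forall p : R, 0 < p < 1 -> p != pcrit ->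
               derivable (@rho R m n) p 1)]].
Proof.
have [c [c01 incP Pmax P'gt0 Pc]] := invp_crit R hm hn.
have m0 : (0 < m)%N by exact: ltnW.
have /andP[c0 c1] := c01.
have Pc0 : 0 < (invp R m n).[c] by exact: invp_gt0.
have rho0 p : 0 <= p <= 1 -> p < (invp R m n).[c]^-1 -> rho m n p = 0.
  exact: rho_subcritical.
have pc0 : 0 < (invp R m n).[c]^-1 by rewrite invr_gt0.
have pc1 : (invp R m n).[c]^-1 <= 1.
  by rewrite invf_le1// -(@invp0 R m n)// Pmax// lexx ler01.
exists (invp R m n).[c]^-1; split => //.
- by rewrite pc0.
- exact: rho_discontinuities.
- by move=> p q; exact: rho_increasing.
have rho_near0 p : 0 < p -> p < (invp R m n).[c]^-1 -> is_derive p 1 (@rho R m n) 0.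
  move=> p0 ppc; apply: (near_eq_is_derive (f := cst 0)) => //.
  near=> y; rewrite rho0//.
    apply/andP; split; apply/ltW; near: y; first exact: lt_nbhsr.
    by apply: lt_nbhsl; exact: lt_le_trans pc1.
  by near: y; exact: lt_nbhsl.
pose V (p : R) := 1 - p * rho m n p.
(* The numerator of the derivative in [rho_branch_derive], as a polynomial so that its limits follow
   from continuity. *)
pose N : {poly R} :=
  (m * n)%:R *: ((1 - 'X^n) ^+ m.-1 * 'X^(n.-1) * invp R m n ^+ 2).
have NE u : N.[u] =
    (m * n)%:R * (1 - u ^+ n) ^+ m.-1 * u ^+ n.-1 * (invp R m n).[u] ^+ 2.
  by rewrite /N; move: (invp R m n) => P; rewrite !hornerE; ring.
(* The ends u = c and u = 0 correspond to the critical value and to p = 1, so strictly between these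
   [V p] is interior to [0, c]. *)
have dE p : (invp R m n).[c]^-1 < p -> p < 1 -> [/\ 0 < V p, V p < c &
    is_derive p 1 (@rho R m n) (N.[V p] / (invp R m n)^`().[V p])].
  move=> pcp p1; have [u uc pE] := branch_surj hn c01 (ltW pcp) (ltW p1).
  have Vu : V p = u by rewrite /V pE (rho_branch m0 hn c1 incP).
  move: uc; rewrite in_itv/= => /andP[u0 uc].
  have {}u0 : 0 < u.
    rewrite lt_neqAle u0 andbT; apply/eqP => uE; move: p1.
    by rewrite pE -uE invp0// invr1 ltxx.
  have {}uc : u < c.
    rewrite lt_neqAle uc andbT; apply/eqP => uE; move: pcp.
    by rewrite pE -uE ltxx.
  rewrite Vu; split => //; rewrite pE NE.
  exact: (rho_branch_derive m0 hn c1 incP P'gt0 u0 uc).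
(* If c = 0 the critical value is 1 and [rho] vanishes on ]0, 1[. *)
have [cE|cgt0] := eqVneq c 0.
  have pcE : (invp R m n).[c]^-1 = 1 by rewrite cE invp0// invr1.
  split; first by rewrite pcE ltxx.
    apply: cvg_near_cst; near=> p; rewrite derive1E.
    have [||_ ->//] := rho_near0 p; rewrite ?pcE; near: p.
      exact: nbhs_left_gt.
    exact: nbhs_left_lt.
  move=> p /andP[p0 p1] _; apply: ex_derive; apply: rho_near0 => //.
  by rewrite pcE.
have {}cgt0 : 0 < c by rewrite lt0r cgt0.
have [n1 P'c] := Pc cgt0.
have pc1' : (invp R m n).[c]^-1 < 1.
  by rewrite invf_lt1// -(@invp0 R m n)//; apply: incP => //; rewrite in_itv/= lexx c0.
have /(continuous_within_itvP _ pc1')[_ Vpc V1] := branch_continuous m0 hn c01 incP.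
have VpcE : V (invp R m n).[c]^-1 = c.
  by rewrite /V (rho_branch m0 hn c1 incP)// in_itv/= c0 lexx.
have V1E : V 1 = 0.
  have z0c : 0 \in `[0, c]%R by rewrite in_itv/= lexx c0.
  by have := rho_branch m0 hn c1 incP z0c; rewrite invp0// invr1.
have {VpcE}Vpc : V p @[p --> (invp R m n).[c]^-1^'+] --> c.
  by move: VpcE Vpc; rewrite /V => ->.
have {V1E}V1 : V p @[p --> 1^'-] --> 0.
  by move: V1E V1; rewrite /V => ->.
have Ngt0 u : 0 < u -> u < 1 -> 0 < N.[u].
  move=> u0 u1; rewrite NE !mulr_gt0 ?exprn_gt0 ?invp_gt0 ?(ltW u0)//.
    by rewrite ltr0n muln_gt0 m0.
  by rewrite subr_gt0 exprn_ilt1 ?(ltW u0)// -lt0n.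
have cvg_horner_V (F : set_system R) (FF : Filter F) (q : {poly R}) l :
    V x @[x --> F] --> l -> q.[V x] @[x --> F] --> q.[l].
  by move=> Vl; exact: (cvg_comp _ _ Vl (@continuous_horner _ _ _)).
split => [_||p /andP[p0 p1] ppc].
- apply: (@cvg_trans _ ((N.[V p] / (invp R m n)^`().[V p])
      @[p --> (invp R m n).[c]^-1^'+])).
    apply: near_eq_cvg; near=> p; rewrite derive1E.
    have [||_ _ [_ ->]//] := dE p.
      by near: p; exact: nbhs_right_gt.
    by near: p; exact: nbhs_right_lt.
  (* The quotient is positive and its inverse tends to P'(c) / N(c) = 0. *)
  apply/gtr0_cvgV0.
    near=> p; have [||Vp0 Vpc' _] := dE p.
    - by near: p; exact: nbhs_right_gt.
    - by near: p; exact: nbhs_right_lt.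
    apply: divr_gt0; first exact: Ngt0 Vp0 (lt_trans Vpc' c1).
    exact: P'gt0 (ltW Vp0) Vpc'.
  apply: (@cvg_trans _ (((invp R m n)^`().[V p] / N.[V p])
      @[p --> (invp R m n).[c]^-1^'+])).
    by apply: near_eq_cvg; near=> p; rewrite /= invf_div.
  rewrite -[0](mul0r N.[c]^-1) -P'c.
  apply: cvgM; first exact: cvg_horner_V.
  by apply: cvgV; [rewrite gt_eqF// Ngt0|exact: cvg_horner_V].
- apply: (@cvg_trans _ ((N.[V p] / (invp R m n)^`().[V p]) @[p --> 1^'-])).
    apply: near_eq_cvg; near=> p; rewrite derive1E.
    have [||_ _ [_ ->]//] := dE p.
      by near: p; exact: nbhs_left_gt.
    by near: p; exact: nbhs_left_lt.
  (* The factor u^(n-1) vanishes at 0 because n > 1, while P'(0) > 0 because 0 < c. *)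
  have N0 : N.[0] = 0.
    have n1' : (0 < n.-1)%N by rewrite -subn1 subn_gt0.
    by rewrite NE !expr0n (gtn_eqF n1') mulr0 mul0r.
  suff : N.[V p] / (invp R m n)^`().[V p] @[p --> 1^'-] -->
      N.[0] / (invp R m n)^`().[0] by rewrite N0 mul0r.
  apply: cvgM; first exact: cvg_horner_V.
  by apply: cvgV; [rewrite gt_eqF// P'gt0|exact: cvg_horner_V].
- have [ppc'|pcp|pE] := ltgtP p (invp R m n).[c]^-1.
  + by apply: ex_derive; apply: rho_near0.
  + by apply: ex_derive; have [_ _] := dE _ pcp p1; exact.
  + by rewrite pE eqxx in ppc.
Unshelve. all: by end_near. Qed.
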